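(* Every topo-isomorphic factor map $\pi\colon X\to Y$ between actions of a countable amenable group $G$ on compact metrizable spaces is mean equicontinuous.
   Context: $G$ is a countable (discrete) amenable group; a Følner sequence is a sequence $(F_n)$ of nonempty finite subsets of $G$ with $|F_n\Delta gF_n|/|F_n|\to 0$ for all $g\in G$. An action $X$ of $G$ is a compact metrizable space $X$ with a homomorphism from $G$ to the homeomorphisms of $X$, written $(g,x)\mapsto g.x$; $d$ denotes a metric inducing the topology of $X$ (the notions below do not depend on its choice). A factor map $\pi\colon X\to Y$ is a continuous surjection with $\pi(g.x)=g.\pi(x)$ for all $g\in G$, $x\in X$, and $R(\pi):=\{(x,x')\in X^2;\ \pi(x)=\pi(x')\}$. The Weyl pseudometric is $D(x,x'):=\sup_{(F_n)}\limsup_{n\to\infty}\frac1{|F_n|}\sum_{g\in F_n}d(g.x,g.x')$, the supremum being over all Følner sequences. A pair $(x,x')$ is Banach proximal if $D(x,x')=0$; a sequence $(x_n,x_n')$ in $X^2$ is asymptotically Banach proximal if $D(x_n,x_n')\to0$. The factor map $\pi$ is mean equicontinuous if for every convergent sequence in $R(\pi)$ the sequence is asymptotically Banach proximal if and only if its limit is Banach proximal. The factor map $\pi$ is topo-isomorphic if for every $G$-invariant Borel probability measure $\mu$ on $X$ there is a Borel set $M\subseteq Y$ with $\pi_*\mu(M)=\mu(\pi^{-1}(M))=1$ such that $\pi$ restricts to a bi-measurable bijection $\pi^{-1}(M)\to M$. *)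

(* Defs.v *)
From HB Require Import structures.
From mathcomp Require Import all_boot all_order all_algebra.
From mathcomp Require Import finmap.
From mathcomp Require Import all_classical all_reals all_analysis.
Set Implicit Arguments.
Unset Strict Implicit.
Unset Printing Implicit Defensive.

Import Order.TTheory GRing.Theory Num.Theory.
Import numFieldNormedType.Exports.

Local Open Scope fset_scope.
Local Open Scope classical_set_scope.
Local Open Scope ring_scope.

Section Folner.
Variables (R : realType) (G : groupType).

Definition fsymdiff (A B : {fset G}) : {fset G} := ((A `\` B) `|` (B `\` A))%fset.

Definition ltranslate (g : G) (A : {fset G}) : {fset G} :=
  [fset (g * h)%g | h in A]%fset.

Definition Folner (F : nat -> {fset G}) : Prop :=
  (forall n, F n != fset0) /\
  (forall g : G,
    (#|` fsymdiff (F n) (ltranslate g (F n)) |%:R / #|` F n |%:R : R)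
      @[n --> \oo] --> (0 : R)).

(* For countable groups, amenability is the existence of a Folner sequence. *)
Definition amenable : Prop := exists F, Folner F.

End Folner.

(* The map of each [g] is a homeomorphism, its inverse being that of [g^-1]. *)
Record taction (G : groupType) (X : topologicalType) := TAction {
  tact_fun :> G -> X -> X ;
  tact1 : forall x, tact_fun 1%g x = x ;
  tactM : forall g h x, tact_fun (g * h)%g x = tact_fun g (tact_fun h x) ;
  tact_continuous : forall g, continuous (tact_fun g)
}.

Record factor_map (G : groupType) (X Y : topologicalType)
    (aX : taction G X) (aY : taction G Y) := FactorMap {
  factor_fun :> X -> Y ;
  factor_continuous : continuous factor_fun ;
  factor_surj : set_surj [set: X] [set: Y] factor_fun ;
  factor_equivariant : forall g x, factor_fun (aX g x) = aY g (factor_fun x)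
}.

Section Weyl.
Variables (R : realType) (G : groupType) (X : metricType R) (aX : taction G X).

(* [limn_esup] and [ereal_sup] are taken in the extended reals; when [X] is
   compact and [G] is amenable the value is finite. *)
Definition Weyl (x x' : X) : \bar R :=
  ereal_sup [set limn_esup (fun n : nat =>
      ((\sum_(g <- F n) mdist (aX g x) (aX g x')) / #|` F n |%:R)%:E)
    | F in Folner R (G := G)].

Definition Banach_proximal (p : X * X) : Prop := Weyl p.1 p.2 = 0%E.

Definition asymptotically_Banach_proximal (u : nat -> X * X) : Prop :=
  Weyl (u n).1 (u n).2 @[n --> \oo] --> 0%E.

End Weyl.

Section MeanEquicontinuity.
Variables (R : realType) (G : groupType) (X Y : metricType R).
Variables (aX : taction G X) (aY : taction G Y) (pi : factor_map aX aY).

Definition factor_relation : set (X * X) := [set p | pi p.1 = pi p.2].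

Definition mean_equicontinuous : Prop :=
  forall (u : nat -> X * X) (p : X * X),
    (forall n, factor_relation (u n)) -> u n @[n --> \oo] --> p ->
    asymptotically_Banach_proximal aX u <-> Banach_proximal aX p.

End MeanEquicontinuity.

(* A [measurableType] has to be pointed, whereas a compact metrizable space may
   be empty; the Borel structure is therefore set up relative to a base point,
   on which neither the sigma-algebra nor its measures depend. *)
Definition pointed_at (T : choiceType) (x0 : T) : Type := T.

Section PointedAt.
Variables (T : choiceType) (x0 : T).
HB.instance Definition _ := Choice.on (pointed_at x0).
HB.instance Definition _ := isPointed.Build (pointed_at x0) x0.
End PointedAt.

Notation Borel x0 :=
  (g_sigma_algebraType (@open _ : set (set (pointed_at x0)))).

Definition bimeasurable_bijection d d' (T : measurableType d)
    (U : measurableType d') (A : set T) (B : set U) (f : T -> U) : Prop :=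
  [/\ set_bij A B f, measurable_fun A f
    & exists s : U -> T, {in A, cancel f s} /\ measurable_fun B s].

Section TopoIsomorphic.
Variables (R : realType) (G : groupType) (X Y : metricType R).
Variables (aX : taction G X) (aY : taction G Y) (pi : factor_map aX aY).

Definition invariant_measure (x0 : X) (mu : probability (Borel x0) R) : Prop :=
  forall (g : G) (A : set (Borel x0)),
    measurable A -> mu (aX g @^-1` A) = mu A.

Definition topo_isomorphic : Prop :=
  forall (x0 : X) (mu : probability (Borel x0) R), invariant_measure mu ->
  exists M : set (Borel (pi x0)),
    [/\ measurable M,
        pushforward mu (pi : Borel x0 -> Borel (pi x0)) M = 1%E
      & bimeasurable_bijection ((pi : Borel x0 -> Borel (pi x0)) @^-1` M) M
          (pi : Borel x0 -> Borel (pi x0))].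

End TopoIsomorphic.

(* Main.v *)
Require Import Defs.
From HB Require Import structures.
From mathcomp Require Import all_boot all_order all_algebra.
From mathcomp Require Import finmap lra.
From mathcomp Require Import all_classical all_reals all_analysis.

(** The Weyl pseudometric of a topo-isomorphic factor map [pi] vanishes on the
    whole relation [R(pi)].  As [R(pi)] is closed, the limit of a convergent
    sequence in [R(pi)] is again in [R(pi)], so both sides of the equivalence
    that defines mean equicontinuity hold outright.

    For the vanishing, let [pi x = pi x'] and suppose that along some Folner
    sequence the averages of [d (g.x, g.x')] exceed some [c > 0] infinitely
    often.  An ultrafilter [U] that contains the set of these indices turns the
    frequencies with which the orbit of [(x, x')] visits a set
    [A] of [X * X] into a limit [m A].  This is a finitely additive, invariant
    set function ([empirical_content_invariant]), and a Borel probability [P] on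
    [X * X] is derived from it which is invariant, is at least [m] on closed
    sets and at most [m] on open sets ([empirical_probability_exists]).  Since the
    orbit stays in the closed set [R(pi)], [P] is carried by [R(pi)].

    The first marginal of [P] is an invariant measure on [X], so [pi] is injective
    over a set [M] of full measure.  For [P]-almost every pair [(y, y')] one has
    [pi y = pi y'] and [pi y] in [M], whence [y = y']: [P] is carried by the
    diagonal ([joining_diagonal]).  Thus the closed set [K] of pairs at distance
    at least [c / 2] satisfies [m K <= P K = 0], and the averages of the
    distance, which are at most [c / 2] plus a constant times the frequency of
    visits to [K], are eventually smaller than [c] along [U], a contradiction.

    The passage from [m] to [P] replaces the Riesz representation theorem:
    [m] is regularized, from inside by closed sets and then from outside by open
    sets, and Caratheodory's theorem applies to the resulting outer measure. *)

Set Implicit Arguments.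
Unset Strict Implicit.
Unset Printing Implicit Defensive.

Import Order.TTheory GRing.Theory Num.Theory.
Import numFieldNormedType.Exports.

Local Open Scope classical_set_scope.
Local Open Scope ring_scope.

(** * Regularization of a finitely additive set function *)

Definition additive_content (R : realType) (Z : Type) (m : set Z -> R) :=
  (forall A, 0 <= m A) /\
  (forall A B, A `&` B = set0 -> m (A `|` B) = m A + m B).

Section AdditiveContent.
Context {R : realType} {Z : Type} {m : set Z -> R}.
Hypothesis m_content : additive_content m.

Lemma content_ge0 A : 0 <= m A.
Proof. exact: m_content.1. Qed.

Lemma contentU A B : A `&` B = set0 -> m (A `|` B) = m A + m B.
Proof. exact: m_content.2. Qed.

Lemma content0 : m set0 = 0.
Proof.
have := contentU (set0I (@set0 Z)); rewrite setU0 => /eqP.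
by rewrite -subr_eq0 opprD addrA subrr add0r oppr_eq0 => /eqP.
Qed.

Lemma le_content A B : A `<=` B -> m A <= m B.
Proof.
move=> AB; have -> : B = A `|` (B `\` A) by rewrite setDUK.
by rewrite contentU ?lerDl ?content_ge0// setDIK.
Qed.

Lemma content_subadditive A B C : A `<=` B `|` C -> m A <= m B + m C.
Proof.
move=> ABC; apply: (@le_trans _ _ (m (B `|` (C `\` B)))).
  apply: le_content => x /ABC; have [Bx|nBx] := pselect (B x); first by left.
  by case=> // Cx; right.
by rewrite contentU ?setDIK// lerD2l; apply: le_content => x [].
Qed.

End AdditiveContent.

Section RegularExtension.
Context {R : realType} {Z : topologicalType}.
Variable m : set Z -> R.
Local Open Scope ereal_scope.

Definition inner_content (U : set Z) : \bar R :=
  ereal_sup [set (m K)%:E | K in [set K | closed K /\ K `<=` U]].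

(** Passing to open supersets makes the set function an outer measure: the
    values of [m] itself are far from countably additive, since mass of [m] may
    escape from an open set to its boundary. *)
Definition regular_content (A : set Z) : \bar R :=
  ereal_inf [set inner_content U | U in [set U | open U /\ A `<=` U]].

Lemma le_inner U V : U `<=` V -> inner_content U <= inner_content V.
Proof.
move=> UV; apply: ereal_sup_le => _ [K [cK KU] <-].
by exists K => //; split => //; exact: subset_trans UV.
Qed.

Lemma inner_ge K U : closed K -> K `<=` U -> (m K)%:E <= inner_content U.
Proof. by move=> cK KU; apply: ereal_sup_ubound; exists K. Qed.

Lemma inner_le U x : (forall K, closed K -> K `<=` U -> (m K)%:E <= x) ->
  inner_content U <= x.
Proof. by move=> h; apply: ge_ereal_sup => _ [K [cK KU] <-]; exact: h. Qed.

Lemma le_regular A B : A `<=` B -> regular_content A <= regular_content B.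
Proof.
move=> AB; apply: ereal_inf_le_tmp => _ [U [oU BU] <-].
by exists U => //; split => //; exact: subset_trans BU.
Qed.

Lemma regular_open U : open U -> regular_content U = inner_content U.
Proof.
move=> oU; apply/eqP; rewrite eq_le; apply/andP; split.
  by apply: ereal_inf_lbound; exists U => //; split => //; exact: subset_refl.
by apply: le_ereal_inf_tmp => _ [V [oV UV] <-]; exact: le_inner.
Qed.

Lemma regular_closed_ge K : closed K -> (m K)%:E <= regular_content K.
Proof.
by move=> cK; apply: le_ereal_inf_tmp => _ [V [oV UV] <-]; exact: inner_ge.
Qed.

Hypothesis m_content : additive_content m.

Lemma inner_ge0 U : 0 <= inner_content U.
Proof.
have <- : (m set0)%:E = 0 by rewrite (content0 m_content).
by apply: inner_ge => //; exact: closed0.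
Qed.

Lemma inner0 : inner_content set0 = 0.
Proof.
apply/eqP; rewrite eq_le inner_ge0 andbT; apply: inner_le => K _.
by rewrite subset0 => ->; rewrite (content0 m_content).
Qed.

Lemma innerT : inner_content setT = (m setT)%:E.
Proof.
apply/eqP; rewrite eq_le; apply/andP; split; last first.
  by apply: inner_ge => //; exact: closedT.
by apply: inner_le => K _ _; rewrite lee_fin le_content.
Qed.

Lemma inner_fin_num U : inner_content U \is a fin_num.
Proof.
rewrite ge0_fin_numE ?inner_ge0// (le_lt_trans (le_inner (@subsetT _ U)))//.
by rewrite innerT ltry.
Qed.

Lemma regular0 : regular_content set0 = 0.
Proof. by rewrite regular_open ?inner0//; exact: open0. Qed.

Lemma regular_ge0 A : 0 <= regular_content A.
Proof. by rewrite -regular0 le_regular. Qed.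

Lemma regular_fin_num A : regular_content A \is a fin_num.
Proof.
rewrite ge0_fin_numE ?regular_ge0// (le_lt_trans (le_regular (@subsetT _ A)))//.
by rewrite regular_open ?innerT ?ltry//; exact: openT.
Qed.

Hypothesis Z_compact : compact [set: Z].
Hypothesis Z_normal : normal_space Z.

(** Normality of the space: shrink [U] to a neighbourhood of the closed set
    [K `\` V] whose closure is still inside [U]. *)
Lemma closed_cover_split (K U V : set Z) : closed K -> open U -> open V ->
  K `<=` U `|` V -> exists K1 K2,
  [/\ closed K1, K1 `<=` U, closed K2, K2 `<=` V & K `<=` K1 `|` K2].
Proof.
move=> cK oU oV KUV.
have cKV : closed (K `\` V).
  by rewrite setDE; apply: closedI => //; exact: open_closedC.
have nU : set_nbhs (K `\` V) U.
  by apply/set_nbhsP; exists U; split => // x [/KUV[]].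
have [W /set_nbhsP[W' [oW' KW' W'W]] WU] := Z_normal cKV nU.
exists (K `&` closure W), (K `\` W'); split.
- by apply: closedI => //; exact: closed_closure.
- by move=> x [_ /WU].
- by rewrite setDE; apply: closedI => //; exact: open_closedC.
- by move=> x [Kx nW]; apply: contrapT => nV; apply: nW; exact: KW'.
- move=> x Kx; have [Wx|nWx] := pselect (W' x); last by right.
  by left; split => //; apply: subset_closure; exact: W'W.
Qed.

Lemma inner_cover (U : (set Z)^nat) n (K : set Z) : closed K ->
  (forall i, open (U i)) -> K `<=` \big[setU/set0]_(i < n) U i ->
  (m K)%:E <= \sum_(i < n) inner_content (U i).
Proof.
move=> cK oU; elim: n K cK => [|n IH] K cK.
  by rewrite !big_ord0 subset0 => ->; rewrite (content0 m_content).
rewrite !big_ord_recr/= => KU.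
have [||K1 [K2 [cK1 K1U cK2 K2U K12]]] := closed_cover_split cK _ _ KU => //.
  by rewrite -bigcup_mkord; apply: bigcup_open => i _; exact: oU.
apply: le_trans (leeD (IH K1 cK1 K1U) (inner_ge cK2 K2U)).
by rewrite -EFinD lee_fin; exact: content_subadditive.
Qed.

(** Countable subadditivity comes from compactness: a closed set covered by
    countably many open sets is covered by finitely many of them, to which finite
    additivity of [m] applies. *)
Lemma inner_bigcup (U : (set Z)^nat) : (forall i, open (U i)) ->
  inner_content (\bigcup_i U i) <= \sum_(i <oo) inner_content (U i).
Proof.
move=> oU; apply: inner_le => K cK KU.
have cptK : compact K by exact: subclosed_compact Z_compact _.
have [n _ /(_ n (leqnn n)) Kn] :
    \forall n \near \oo, K `<=` \big[setU/set0]_(i < n) U i.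
  move/compact_near_coveringP : cptK => /(_ nat \oo) covK.
  apply: (covK (fun n => \big[setU/set0]_(i < n) U i)) => x /KU[i _ Uix].
  near=> y n => /=; rewrite -bigcup_mkord; exists i => /=.
    by near: n; exact: nbhs_infty_gt.
  by near: y; apply: open_nbhs_nbhs.
rewrite (le_trans (inner_cover cK oU Kn))//.
rewrite -(big_mkord xpredT (inner_content \o U)).
by apply: nneseries_lim_ge => i _ _; exact: inner_ge0.
Unshelve. all: by end_near. Qed.

(** Each set is replaced by an open superset with an error from a summable
    sequence, which reduces the claim to open sets. *)
Lemma regular_sigma_subadditive : sigma_subadditive regular_content.
Proof.
move=> A; apply/lee_addgt0Pr => e e0.
apply: le_trans (epsilon_trick xpredT (fun n => regular_ge0 (A n)) (ltW e0)).
have en n : (0 < e / (2 ^ n.+1)%:R)%R by rewrite divr_gt0// ltr0n expn_gt0.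
have /choice[U HU] n : exists U : set Z, [/\ open U, A n `<=` U &
    inner_content U <= regular_content (A n) + (e / (2 ^ n.+1)%:R)%:E].
  have [_ [U [oU AU] <-] ltU] :=
    lb_ereal_inf_adherent (en n) (regular_fin_num (A n)).
  by exists U; split => //; exact: ltW.
have oU n : open (U n) by have [] := HU n.
apply: (@le_trans _ _ (inner_content (\bigcup_n U n))).
  apply: ereal_inf_lbound; exists (\bigcup_n U n) => //; split.
    exact: bigcup_open.
  by move=> x [n _ Ax]; exists n => //; have [_ + _] := HU n; apply.
apply: (le_trans (inner_bigcup oU)).
apply: lee_nneseries => [n _ _|n _]; first exact: inner_ge0.
by have [] := HU n.
Qed.

HB.instance Definition _ := isOuterMeasure.Build R Z regular_content
  regular0 regular_ge0 le_regular regular_sigma_subadditive.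

(** Inside an open set [V], exhaust [V `&` U] by a closed set [K] and then the
    open set [V `\` K], which contains the rest [V `\` U], by a closed set [L].
    Then [K] and [L] are disjoint closed subsets of [V], and [m] is additive on
    them. *)
Lemma regular_caratheodory_open U : open U ->
  caratheodory_measurable regular_content U.
Proof.
move=> oU; apply: le_caratheodory_measurable => X.
apply: le_ereal_inf_tmp => _ [V [oV XV] <-].
apply: (@le_trans _ _ (inner_content (V `&` U) + regular_content (V `&` ~` U))).
  apply: leeD; last by apply: le_regular; exact: setSI.
  rewrite -regular_open; last exact: openI.
  by apply: le_regular; exact: setSI.
rewrite -leeBrDr ?regular_fin_num//; apply: inner_le => K cK KVU.
rewrite leeBrDr ?regular_fin_num//.
have oVK : open (V `\` K).
  by rewrite setDE; apply: openI => //; exact: closed_openC.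
apply: (@le_trans _ _ ((m K)%:E + inner_content (V `\` K))).
  rewrite leeD2l// -regular_open//; apply: le_regular => x [Vx nUx].
  by split => // /KVU[].
rewrite -leeBrDl//; apply: inner_le => L cL LVK.
rewrite leeBrDl// -EFinD -(contentU m_content); last first.
  by apply/disjoints_subset => x Kx /LVK[].
apply: inner_ge; first exact: closedU.
by move=> x [/KVU[]|/LVK[]].
Qed.

Variable z0 : Z.
Hypothesis m_setT : (m setT = 1)%R.

Let nu (A : set (Borel z0)) : \bar R := regular_content A.

Let Borel_caratheodory (A : set (Borel z0)) : measurable A ->
  caratheodory_measurable regular_content A.
Proof.
apply: smallest_sub => [|U oU]; last exact: regular_caratheodory_open.
exact: (@sigma_algebra_measurable _
  (caratheodory_type (regular_content : set (pointed_at z0) -> \bar R))).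
Qed.

Let nu_sigma_additive : semi_sigma_additive nu.
Proof.
move=> F mF tF _.
apply: (@caratheodory_measure_sigma_additive R (pointed_at z0)
  regular_content) => //.
  by move=> i; exact: Borel_caratheodory.
by apply: caratheodory_measurable_bigcup => i; exact: Borel_caratheodory.
Qed.

HB.instance Definition _ := isMeasure.Build _ _ _ nu
  regular0 regular_ge0 nu_sigma_additive.

Let nu_setT : nu setT = 1.
Proof. by rewrite /nu regular_open ?innerT ?m_setT//; exact: openT. Qed.

HB.instance Definition _ := Measure_isProbability.Build _ _ _ nu nu_setT.

(** A substitute for the Riesz representation theorem on a compact space; the
    explicit value of [P] on Borel sets is what transfers invariance and
    estimates from [m] to [P]. *)
Lemma regular_probability_exists : exists P : probability (Borel z0) R,
  forall A, P A = regular_content A.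
Proof. by exists nu. Qed.

End RegularExtension.

(** One inequality holds by carrying open and closed sets along the
    homeomorphism; the other is the same inequality for the inverse. *)
Lemma regular_content_homeo (R : realType) (Z : topologicalType)
    (m : set Z -> R) (phi psi : Z -> Z) :
  continuous phi -> continuous psi -> cancel phi psi -> cancel psi phi ->
  (forall A, m (phi @^-1` A) = m A) ->
  forall A, regular_content m (phi @^-1` A) = regular_content m A.
Proof.
have half f g (A : set Z) : continuous f -> continuous g -> cancel g f ->
    (forall A, m (g @^-1` A) = m A) ->
    (regular_content m (f @^-1` A) <= regular_content m A)%E.
  move=> cf cg fK mg; apply: le_ereal_inf_tmp => _ [U [oU AU] <-].
  apply: (@le_trans _ _ (inner_content m (f @^-1` U))).
    apply: ereal_inf_lbound; exists (f @^-1` U) => //; split.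
      by apply: open_comp => // x _; exact: cf.
    by move=> x /AU.
  apply: inner_le => K cK KU; rewrite -mg; apply: inner_ge.
    by apply: preimage_closed => // x _; exact: cg.
  by move=> x /KU /=; rewrite fK.
move=> cphi cpsi phiK psiK mphi A; apply/eqP; rewrite eq_le; apply/andP; split.
  apply: (half phi psi) => // B; rewrite -[LHS]mphi; congr m.
  by apply/seteqP; split=> x /=; rewrite phiK.
have {1}-> : A = psi @^-1` (phi @^-1` A).
  by apply/seteqP; split=> x /=; rewrite psiK.
exact: (half psi phi).
Qed.

(** * Averages over finite subsets of a group *)

Section FiniteAverages.
Context {R : realType} {G : groupType}.
Implicit Types (F : {fset G}) (f : G -> R).

Definition average F f : R := (\sum_(g <- F) f g) / #|` F |%:R.

Lemma le_average F f f' : (forall g, f g <= f' g) -> average F f <= average F f'.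
Proof.
by move=> ff'; rewrite ler_wpM2r ?invr_ge0 ?ler0n// ler_sum.
Qed.

Lemma averageD F f f' :
  average F (fun g => f g + f' g) = average F f + average F f'.
Proof. by rewrite /average big_split mulrDl. Qed.

Lemma averageZ F f c : average F (fun g => c * f g) = c * average F f.
Proof. by rewrite /average -mulr_sumr mulrA. Qed.

Lemma average_cst F c : F != fset0 -> average F (fun=> c) = c.
Proof.
move=> F0; rewrite /average big_const_seq count_predT iter_addr_0.
rewrite -[_ *+ _]mulr_natr mulfK//.
by rewrite pnatr_eq0 cardfs_eq0.
Qed.

Lemma sum_ltranslate F f g :
  \sum_(h <- ltranslate g F) f h = \sum_(h <- F) f (g * h)%g.
Proof.
rewrite (perm_big _ (enum_imfset _ _))/= ?big_map//.
by move=> x y _ _ /mulgI.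
Qed.

Lemma sum_fsetB_le F F' f : (forall g, 0 <= f g <= 1) ->
  \sum_(h <- F) f h - \sum_(h <- F') f h <= #|` (F `\` F')%fset |%:R.
Proof.
move=> f01; rewrite (big_fsetID _ (mem F') F) (big_fsetID _ (mem F) F') /=.
have -> : [fset x in F' | x \in F]%fset = [fset x in F | x \in F']%fset.
  by apply/fsetP => x; rewrite !inE andbC.
have -> : [fset x in F | x \notin F']%fset = (F `\` F')%fset.
  by apply/fsetP => x; rewrite !inE andbC.
(* The common part cancels, and the part of [F'] outside [F] only helps. *)
rewrite opprD addrACA addrN add0r lerBlDr.
apply: (@le_trans _ _ #|` (F `\` F')%fset |%:R).
  rewrite card_fset_sum1 natr_sum ler_sum// => h _.
  by have /andP[] := f01 h.
by rewrite lerDl sumr_ge0// => h _; have /andP[] := f01 h.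
Qed.

(** Translating the function amounts to translating the finite set, and the two
    sums then differ by terms in the symmetric difference only. *)
Lemma average_ltranslate_le F f g : (forall g, 0 <= f g <= 1) ->
  `|average F (fun h => f (g * h)%g) - average F f| <=
  #|` fsymdiff F (ltranslate g F) |%:R / #|` F |%:R.
Proof.
move=> f01; rewrite /average -sum_ltranslate -mulrBl normrM.
rewrite [X in _ * X]ger0_norm ?invr_ge0//.
rewrite ler_wpM2r ?invr_ge0// ler_norml.
rewrite lerNl opprB; apply/andP; split.
  apply: (le_trans (sum_fsetB_le _ _ f01)); rewrite ler_nat fsubset_leq_card//.
  exact: fsubsetUl.
apply: (le_trans (sum_fsetB_le _ _ f01)); rewrite ler_nat fsubset_leq_card//.
exact: fsubsetUr.
Qed.

End FiniteAverages.

(** A bounded family has a cluster point by compactness of the segment, and an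
    ultrafilter converges to any of its cluster points. *)
Lemma ultra_bounded_cvg (R : realType) (T : Type) (U : set_system T)
    (f : T -> R) a b :
  UltraFilter U -> (forall t, a <= f t <= b) -> cvg (f t @[t --> U]).
Proof.
move=> UU fab; have [|l [_ Ul]] := @segment_compact R a b (f @ U).
  by apply: nearW => t /=; rewrite in_itv/=; exact: fab.
apply/cvg_ex; exists l => A nA; rewrite /= /fmap/=.
have [//|nfA] := in_ultra_setVsetC (f @^-1` A) UU.
by have [x [/= nAx Ax]] := Ul (~` A) A nfA nA.
Qed.


(** * Limits of empirical measures along an ultrafilter *)

Section EmpiricalContent.
Context {R : realType} {G : groupType} {Z : topologicalType}.
Variables (aZ : taction G Z) (F : nat -> {fset G}) (U : set_system nat) (z : Z).
Hypothesis FF : Folner R F.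
Hypothesis UU : UltraFilter U.
Hypothesis Uoo : \oo `<=` U.

Definition visit_frequency n (A : set Z) : R :=
  average (F n) (fun g => \1_A (aZ g z)).

Definition empirical_content (A : set Z) : R :=
  lim (visit_frequency n A @[n --> U]).

Lemma indic01 (A : set Z) x : 0 <= (\1_A x : R) <= 1.
Proof. by rewrite indicE ler0n lern1 leq_b1. Qed.

Lemma visit_frequency_itv n A : 0 <= visit_frequency n A <= 1.
Proof.
have F0 := FF.1 n; apply/andP; split.
  rewrite -(average_cst 0 F0); apply: le_average => g.
  by case/andP: (indic01 A (aZ g z)).
rewrite -[leRHS](average_cst 1 F0); apply: le_average => g.
by case/andP: (indic01 A (aZ g z)).
Qed.

Lemma visit_frequency_cvg A :
  visit_frequency n A @[n --> U] --> empirical_content A.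
Proof. exact: (ultra_bounded_cvg UU (visit_frequency_itv ^~ A)). Qed.

Lemma empirical_contentE A (l : R) :
  visit_frequency n A @[n --> U] --> l -> empirical_content A = l.
Proof. by move=> vl; apply/cvg_lim. Qed.

Lemma empirical_content_cst A (c : R) :
  (forall g, \1_A (aZ g z) = c) -> empirical_content A = c.
Proof.
move=> Ac; apply: empirical_contentE; rewrite /visit_frequency.
under eq_fun do under eq_fun do rewrite Ac.
under eq_fun do rewrite average_cst ?(FF.1)//.
exact: cvg_cst.
Qed.

Lemma empirical_content_additive : additive_content empirical_content.
Proof.
split=> [A|A B AB].
  apply: limr_ge; first exact: visit_frequency_cvg.
  by apply: nearW => n; case/andP: (visit_frequency_itv n A).
apply: empirical_contentE.
rewrite (_ : visit_frequency ^~ _ =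
    visit_frequency ^~ A \+ visit_frequency ^~ B).
  by apply: cvgD; exact: visit_frequency_cvg.
apply/funext => n; rewrite /= -averageD; congr average; apply/funext => g.
rewrite !indicE in_setU; have /disjoints_subset/(_ (aZ g z)) := AB.
have [Ax|nAx] := boolP (aZ g z \in A) => /=; last by rewrite add0r.
by move=> /(_ (set_mem Ax)) nBx; rewrite memNset ?addr0.
Qed.

Lemma empirical_contentT : empirical_content setT = 1.
Proof. by apply: empirical_content_cst => g; rewrite indicT. Qed.

(** The Folner condition makes the difference of the two frequencies tend to
    [0]. *)
Lemma empirical_content_invariant g A :
  empirical_content (aZ g @^-1` A) = empirical_content A.
Proof.
have := @visit_frequency_cvg (aZ g @^-1` A).
set v := visit_frequency ^~ _; set w := visit_frequency ^~ A => vl.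
apply/esym/empirical_contentE.
rewrite -[X in _ --> X]subr0 -[visit_frequency ^~ A]/w.
have -> : w = v - (v - w) by apply/funext => n; rewrite !fctE subKr.
apply: cvgB => //; apply: norm_cvg0.
apply: (@squeeze_cvgr _ _ _ _ (cst 0)
  (fun n => #|` fsymdiff (F n) (ltranslate g (F n)) |%:R / #|` F n |%:R)).
- apply: nearW => n; rewrite normr_ge0/= fctE.
  have := average_ltranslate_le (F n) g (fun h => indic01 A (aZ h z)).
  apply: le_trans; rewrite le_eqVlt; apply/orP; left; apply/eqP.
  congr (`|average _ _ - _|); apply/funext => h.
  by rewrite !indicE tactM.
- exact: cvg_cst.
- by apply: (cvg_trans _ (FF.2 g)) => A' ?; exact: Uoo.
Qed.

End EmpiricalContent.

(** The existence of invariant measures in the style of Krylov and Bogolyubov,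
    with the two inequalities of the portmanteau theorem for convergence along
    [U]. *)
Lemma empirical_probability_exists (R : realType) (G : groupType)
    (Z : topologicalType) (aZ : taction G Z) (F : nat -> {fset G})
    (U : set_system nat) (z z0 : Z) :
  Folner R F -> UltraFilter U -> \oo `<=` U ->
  compact [set: Z] -> hausdorff_space Z ->
  exists P : probability (Borel z0) R,
    [/\ forall g A, P (aZ g @^-1` A) = P A,
        forall K, closed K -> ((empirical_content aZ F U z K : R)%:E <= P K)%E
      & forall W, open W -> (P W <= (empirical_content aZ F U z W)%:E)%E].
Proof.
move=> FF UU Uoo cZ hZ.
have mC := empirical_content_additive aZ z FF UU.
have [P PE] := regular_probability_exists mC cZ (compact_normal hZ cZ) z0
  (empirical_contentT aZ z FF UU).
exists P; split=> [g A|K cK|W oW]; rewrite !PE.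
- have gK h x : aZ h^-1%g (aZ h x) = x by rewrite -tactM mulVg tact1.
  have gVK h x : aZ h (aZ h^-1%g x) = x by rewrite -tactM mulgV tact1.
  apply: (regular_content_homeo (psi := aZ g^-1%g)) => //;
    try exact: tact_continuous.
  by move=> B; exact: empirical_content_invariant.
- exact: regular_closed_ge.
- rewrite regular_open//; apply: inner_le => K cK KW.
  by rewrite lee_fin le_content.
Qed.

(** * Continuity, products and upper limits *)

Lemma prod_hausdorff (X Y : topologicalType) :
  hausdorff_space X -> hausdorff_space Y -> hausdorff_space (X * Y)%type.
Proof.
move=> hX hY [p1 p2] [q1 q2] pq; congr pair.
  apply: hX => A B nA nB.
  have [|| [x y] [[/= Ax _] [/= Bx _]]] := pq (A `*` setT) (B `*` setT).
  - by exists (A, setT) => //; split => //; exact: filterT.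
  - by exists (B, setT) => //; split => //; exact: filterT.
  by exists x.
apply: hY => A B nA nB.
have [|| [x y] [[/= _ Ay] [/= _ By]]] := pq (setT `*` A) (setT `*` B).
- by exists (setT, A) => //; split => //; exact: filterT.
- by exists (setT, B) => //; split => //; exact: filterT.
by exists y.
Qed.

Lemma mdist_continuous (R : realType) (X : metricType R) :
  continuous (fun p : X * X => mdist p.1 p.2 : R).
Proof.
move=> [a b]; apply/cvgrPdist_lt => e e0 /=.
have e20 : 0 < e / 2 by rewrite divr_gt0.
near=> p.
have ap : mdist a p.1 < e / 2.
  near: p; exists (ball a (e / 2), setT) => /=.
    by split; [exact: nbhsx_ballx|exact: filterT].
  by move=> p [/=]; rewrite ballEmdist.
have bp : mdist b p.2 < e / 2.
  near: p; exists (setT, ball b (e / 2)) => /=.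
    by split; [exact: filterT|exact: nbhsx_ballx].
  by move=> p [/=]; rewrite ballEmdist.
rewrite ltr_norml; have T := metric_triangle; apply/andP; split.
  have := T _ _ p.1 a p.2; have := T _ _ a b p.2.
  rewrite (metric_sym p.1 a); lra.
have := T _ _ a p.1 b; have := T _ _ p.1 p.2 b.
rewrite (metric_sym p.2 b); lra.
Unshelve. all: by end_near. Qed.

Lemma mdist_bounded (R : realType) (X : metricType R) : compact [set: X] ->
  exists D : R, forall x y : X, mdist x y <= D.
Proof.
move=> cX; have cXX : compact [set: X * X].
  by rewrite -setXTT; exact: compact_setX.
have cd : {within [set: X * X], continuous (fun p : X * X => mdist p.1 p.2 : R)}.
  by apply: continuous_subspaceT; exact: mdist_continuous.
have /(continuous_compact cd)/compact_bounded[N [_ /(_ (N + 1))]] := cXX.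
rewrite ltrDl => /(_ ltr01) dN; exists (N + 1) => x y.
apply: (le_trans (ler_norm _)); apply: (dN (mdist x y)); exists (x, y) => //.
Qed.

Section DiagonalAction.
Context {G : groupType} {X : topologicalType}.
Variable aX : taction G X.

Let diag (g : G) (p : X * X) := (aX g p.1, aX g p.2).

Let diag1 p : diag 1%g p = p.
Proof. by case: p => x y; rewrite /diag !tact1. Qed.

Let diagM g h p : diag (g * h)%g p = diag g (diag h p).
Proof. by rewrite /diag !tactM. Qed.

Let diag_continuous g : continuous (diag g).
Proof.
move=> p; apply: cvg_pair => /=.
  by apply: continuous_comp; [exact: cvg_fst|exact: tact_continuous].
by apply: continuous_comp; [exact: cvg_snd|exact: tact_continuous].
Qed.

Definition diagonal_action : taction G (X * X)%type :=
  TAction diag1 diagM diag_continuous.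

End DiagonalAction.

Lemma Borel_continuous (X Y : topologicalType) (x0 : X) (y0 : Y) (f : X -> Y) :
  continuous f -> measurable_fun setT (f : Borel x0 -> Borel y0).
Proof.
move=> cf; apply: (@measurability _ _ (Borel x0) (Borel y0) setT f
  (@open Y : set (set (pointed_at y0)))) => //.
move=> _ [V oV <-]; rewrite setTI; apply: sub_sigma_algebra.
by apply: open_comp => // x _; exact: cf.
Qed.

(** Infinitely many indices satisfy [c < u n]; an ultrafilter that refines the
    filter below sees all of [u] above [c]. *)
Lemma limn_esup_gt_within (R : realType) (u : nat -> \bar R) (c : \bar R) :
  (c < limn_esup u)%E -> ProperFilter (within [set n | (c < u n)%E] \oo).
Proof.
move=> cu; apply: Build_ProperFilter => /= ule.
suff : (limn_esup u <= c)%E by rewrite leNgt cu.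
apply: ge_ereal_inf; exists (ereal_sup (u @` [set n | ~ (c < u n)%E])).
  by exists [set n | ~ (c < u n)%E].
by apply: ge_ereal_sup => _ [n /= /negP + <-]; rewrite leNgt.
Qed.

Lemma limn_esup_ge0 (R : realType) (u : nat -> \bar R) :
  (forall n, (0 <= u n)%E) -> (0 <= limn_esup u)%E.
Proof.
move=> u0; apply: le_ereal_inf_tmp => _ [A ooA <-].
have [n An] := filter_ex (ooA : (\oo : set_system nat) A).
by apply: le_trans (u0 n) (ereal_sup_ubound _); exists n.
Qed.

(** * The Weyl pseudometric of a topo-isomorphic factor map *)

Section TopoIsomorphic.
Context {R : realType} {G : groupType} {X Y : metricType R}.
Context {aX : taction G X} {aY : taction G Y} { pi : factor_map aX aY}.
Hypothesis pi_iso : topo_isomorphic pi.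

Lemma factor_relation_closed : closed (factor_relation pi).
Proof.
have -> : factor_relation pi =
    (fun p : X * X => mdist (pi p.1) (pi p.2)) @^-1` [set 0].
  apply/seteqP; split=> p /=; rewrite /factor_relation/=.
    by move->; rewrite mdistxx.
  exact: mdist_positivity.
apply: preimage_closed => [p _|]; last exact: closed_eq.
apply: (@continuous_comp _ _ _ (fun p : X * X => (pi p.1, pi p.2))
  (fun q : Y * Y => mdist q.1 q.2)); last exact: mdist_continuous.
apply: cvg_pair => /=.
  by apply: continuous_comp; [exact: cvg_fst|exact: factor_continuous].
by apply: continuous_comp; [exact: cvg_snd|exact: factor_continuous].
Qed.

(** An invariant measure on [R(pi)] is carried by the diagonal: only its first
    marginal has to be tested against topo-isomorphism, because for a pair in
    [R(pi)] the second point lies over [M] as soon as the first one does. *)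
Lemma joining_diagonal (z0 : X * X) (P : probability (Borel z0) R)
    (K : set (X * X)) :
  (forall g A, P (diagonal_action aX g @^-1` A) = P A) ->
  P (~` factor_relation pi) = 0%E ->
  closed K -> (forall x, ~ K (x, x)) -> P K = 0%E.
Proof.
move=> Pinv PR cK KD.
have mB (A : set (X * X)) : open A -> measurable (A : set (Borel z0)).
  exact: sub_sigma_algebra.
have mfst : measurable_fun setT (fst : Borel z0 -> Borel z0.1).
  by apply: Borel_continuous => p; exact: cvg_fst.
pose mu : probability (Borel z0.1) R := distribution P (mfun_Sub (mem_set mfst)).
have muE A : mu A = P (fst @^-1` A) by [].
have muinv : invariant_measure aX mu.
  by move=> g A _; rewrite !muE -(Pinv g (fst @^-1` A)).
have [M [mM muM [[_ injM _] _ _]]] := pi_iso muinv.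
have mpi : measurable_fun setT (pi : Borel z0.1 -> Borel (pi z0.1)).
  by apply: Borel_continuous; exact: factor_continuous.
have mpiM : measurable (pi @^-1` M : set (Borel z0.1)).
  by rewrite -[X in measurable X]setTI; exact: mpi.
have mN : measurable (fst @^-1` (~` (pi @^-1` M)) : set (Borel z0)).
  by rewrite -[X in measurable X]setTI; apply: (mfst) => //; exact: measurableC.
have PN : P (fst @^-1` (~` (pi @^-1` M))) = 0%E.
  by rewrite -muE probability_setC// [X in (1 - X)%E]muM subee.
have mR : measurable (~` factor_relation pi : set (Borel z0)).
  by apply: mB; apply: closed_openC; exact: factor_relation_closed.
pose N : set (Borel z0) :=
  fst @^-1` (~` (pi @^-1` M)) `|` ~` factor_relation pi.
apply: (@subset_measure0 _ (Borel z0) R P K N).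
- by rewrite -[K]setCK; apply: measurableC; apply: mB; exact: closed_openC.
- exact: measurableU.
- move=> [x x'] Kx; apply: contrapT => /not_orP[/= /contrapT Mx /contrapT Rx].
  have xx' : x = x'.
    by apply: injM => //; rewrite inE//=; move: Rx;
      rewrite /factor_relation/= => <-.
  by apply: (KD x); rewrite {2}xx'.
- exact: etrans (measureU0 mN mR PR) PN.
Qed.

Hypothesis X_compact : compact [set: X].

(** If the upper limit were positive, an ultrafilter would see averages above
    some [c > 0] whereas the limiting frequency of pairs at distance at least
    [c / 2] vanishes. *)
Lemma topo_isomorphic_limn_esup_le0 F (x x' : X) : Folner R F -> pi x = pi x' ->
  (limn_esup (fun n =>
    (average (F n) (fun g => mdist (aX g x) (aX g x')))%:E) <= 0)%E.
Proof.
move=> FF pixx'; rewrite leNgt; apply/negP => limsup_gt0.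
set d := fun n => _ in limsup_gt0.
have [c c0 clim] : exists2 c : R, 0 < c & (c%:E < limn_esup d)%E.
  case: (limn_esup d) limsup_gt0 => [r|_|]//.
    by rewrite lte_fin => r0; exists (r / 2); rewrite ?lte_fin; lra.
  by exists 1; rewrite ?ltry.
have [U [UU wU]] := ultraFilterLemma (limn_esup_gt_within clim).
have Uoo : \oo `<=` U.
  by move=> A ooA; apply: wU; rewrite /within/=; apply: filterS ooA => n An _.
have Uc : U [set n | c < average (F n) (fun g => mdist (aX g x) (aX g x'))].
  by apply: wU; apply: filterS (withinT _ _) => n /=; rewrite lte_fin.
pose m := @empirical_content R G _ (diagonal_action aX) F U (x, x').
pose K := [set p : X * X | c / 2 <= mdist p.1 p.2].
have cK : closed K.
  have : closed [set r : R | c / 2 <= r] by exact: closed_ge.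
  by apply: preimage_closed => p _; exact: mdist_continuous.
have mK : m K = 0.
  have X2_compact : compact [set: X * X].
    by rewrite -setXTT; exact: compact_setX.
  have X2_hausdorff : hausdorff_space (X * X)%type.
    by apply: prod_hausdorff; exact: metric_hausdorff.
  have [P [Pinv PK PW]] := empirical_probability_exists (diagonal_action aX)
    (x, x') (x, x') FF UU Uoo X2_compact X2_hausdorff.
  have [m_ge0 _] := empirical_content_additive (diagonal_action aX) (x, x') FF UU.
  apply/eqP; rewrite eq_le m_ge0 andbT -lee_fin (le_trans (PK K cK))//.
  rewrite (joining_diagonal Pinv)//.
    apply/eqP; rewrite eq_le measure_ge0 andbT (le_trans (PW _ _))//.
      by apply: closed_openC; exact: factor_relation_closed.
    rewrite lee_fin le_eqVlt; apply/orP; left; apply/eqP.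
    apply: empirical_content_cst => // g.
    rewrite indicE memNset//; apply;
    by rewrite /factor_relation/= !factor_equivariant pixx'.
  by move=> y; rewrite /K/= mdistxx leNgt divr_gt0.
have [D dD] := mdist_bounded X_compact.
have : c <= c / 2 + D * m K.
  pose freq n : R := visit_frequency (diagonal_action aX) F (x, x') n K.
  apply: (@closed_cvg _ _ U _ (fun n => c / 2 + D * freq n) (fun r => c <= r)).
  - exact: closed_ge.
  (* Pointwise, the distance is at most [c / 2] off [K] and at most [D] on it. *)
  - apply: filterS Uc => n /= /ltW /le_trans; apply.
    rewrite -[c / 2](average_cst _ (FF.1 n)) -averageZ -averageD.
    apply: le_average => g.
    rewrite indicE; have [gK|] := boolP (_ \in K).
      rewrite mulr1 (le_trans (dD _ _))// lerDr; lra.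
    rewrite notin_setE /K/= => /negP; rewrite -ltNge mulr0 addr0; exact: ltW.
  - apply: cvgD; first exact: cvg_cst.
    by apply: cvgMl_tmp; exact: visit_frequency_cvg.
by rewrite mK mulr0 addr0; lra.
Qed.

Lemma topo_isomorphic_Weyl0 x x' :
  amenable R G -> pi x = pi x' -> Weyl aX x x' = 0%E.
Proof.
move=> [F0 FF0] pixx'; apply/eqP; rewrite eq_le; apply/andP; split.
  by apply: ge_ereal_sup => _ [F FF <-]; exact: topo_isomorphic_limn_esup_le0.
apply: le_trans (ereal_sup_ubound _); last by exists F0.
apply: limn_esup_ge0 => n; rewrite lee_fin.
by rewrite divr_ge0 ?ler0n// sumr_ge0// => g _; exact: mdist_ge0.
Qed.

End TopoIsomorphic.

Theorem corollary8p2 (R : realType) (G : groupType) (X Y : metricType R)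
    (aX : taction G X) (aY : taction G Y) (pi : factor_map aX aY) :
  countable [set: G] -> amenable R G ->
  compact [set: X] -> compact [set: Y] ->
  topo_isomorphic pi -> mean_equicontinuous pi.
Proof.
move=> _ amG cX _ pi_iso u p uR up.
have pR : factor_relation pi p.
  apply: (closed_cvg (factor_relation pi) _ _ _ up); last exact: nearW.
  exact: factor_relation_closed.
have W0 q : factor_relation pi q -> Weyl aX q.1 q.2 = 0%E.
  exact: topo_isomorphic_Weyl0.
split=> _; first exact: W0.
rewrite /asymptotically_Banach_proximal.
under eq_fun do rewrite W0//.
exact: cvg_cst.
Qed.
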